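(* For all $c\ge 0$ there exists $d\ge 0$ such that if $T$ is a tournament with $\chi(T)\ge d$, then there is a complete pair $(A,B)$ of $T$ such that $A$ is a cyclic triangle and $\chi(B)\ge c$.
   Context: All tournaments are finite. The chromatic number $\chi(T)$ of a tournament $T$ is the minimum $k$ such that $V(T)$ is the union of $k$ sets each inducing an acyclic (transitive) subtournament. For $X\subseteq V(T)$, $T[X]$ is the subtournament induced on $X$ and $\chi(X)$ means $\chi(T[X])$. A pair $(A,B)$ of disjoint subsets of $V(T)$ is a complete pair (written $A\Rightarrow B$) if there is no edge with tail in $B$ and head in $A$, i.e. every edge between $A$ and $B$ is directed from $A$ to $B$. A cyclic triangle is a tournament with three vertices, each of out-degree one; the same name is used for a vertex set inducing such a subtournament. *)

(* Defs.v *)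
From mathcomp Require Import all_boot.

Set Implicit Arguments.
Unset Strict Implicit.
Unset Printing Implicit Defensive.

Record tournament := Tournament {
  vertex :> finType;
  arc : rel vertex;  (* [arc x y]: the edge xy has tail x and head y *)
  arc_irr : irreflexive arc;
  arc_tour : forall x y, x != y -> arc x y (+) arc y x }.

Arguments arc {t} x y.

(* [T[X]] has no directed cycle. The vertices of a directed cycle are distinct,
   so bounding the length by #|T| loses nothing (see [acyclicP]) and makes the
   predicate boolean. *)
Definition acyclic (T : tournament) (X : {set T}) : bool :=
  [forall k : 'I_#|T|, forall c : (k.+1).-tuple T,
     ucycleb arc c ==> ~~ all [in X] c].

Lemma acyclicP (T : tournament) (X : {set T}) :
  reflect (forall c : seq T, c != [::] -> ucycle arc c -> ~ {subset c <= X})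
          (acyclic X).
Proof.
apply: (iffP forallP) => [acX [|x c] // _ uc sub | acX k].
- have lt_c : size c < #|T|.
    by case/andP: (uc) => _ /card_uniqP/=<-; apply: max_card.
  have /forallP/(_ (in_tuple (x :: c))) := acX (Ordinal lt_c).
  move=> /implyP/(_ uc)/negP; apply; apply/allP; exact: sub.
- apply/forallP => c; apply/implyP => uc; apply/negP => /allP sub.
  by apply: (acX c) uc sub; rewrite -size_eq0 size_tuple.
Qed.

Definition colorable (T : tournament) (X : {set T}) (k : nat) : bool :=
  [exists F : {ffun 'I_k -> {set T}},
     (X == \bigcup_i F i) && [forall i, acyclic (F i)]].

Lemma acyclic1 (T : tournament) (x : T) : acyclic [set x].
Proof.
apply/acyclicP => -[|y [|z c]] // _ /andP[+ uc] sub.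
  by rewrite /= arc_irr.
have /set1P yx := sub y (mem_head _ _).
have /set1P zx : z \in [set x] by apply: sub; rewrite !inE eqxx orbT.
by move: uc; rewrite /= yx zx mem_head.
Qed.

Lemma colorable_ex (T : tournament) (X : {set T}) : exists k, colorable X k.
Proof.
exists #|X|; apply/existsP; exists [ffun i => [set enum_val i]].
apply/andP; split; last by apply/forallP => i; rewrite ffunE acyclic1.
apply/eqP/setP => x; apply/idP/bigcupP => [xX | [i _]].
- by exists (enum_rank_in xX x); rewrite // ffunE enum_rankK_in ?set11.
- by rewrite ffunE => /set1P->; apply: enum_valP.
Qed.

(* The chromatic number of [T[X]]; that of [T] is [chi [set: T]]. *)
Definition chi (T : tournament) (X : {set T}) : nat :=
  ex_minn (colorable_ex X).

Definition complete_pair (T : tournament) (A B : {set T}) : Prop :=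
  [disjoint A & B] /\ forall a b, a \in A -> b \in B -> ~~ arc b a.

Definition cyclic_triangle (T : tournament) (A : {set T}) : Prop :=
  #|A| = 3 /\ forall x, x \in A -> #|[set y in A | arc x y]| = 1.

(* Main.v *)
(** Suppose that no cyclic triangle dominates a set of chromatic number [c].
    Then every [X] with [chi X] large contains, for each fixed [k], a set of
    bounded size with chromatic number at least [k].  By induction on [k]:
    vertices with out-neighbourhood of small chromatic number form a set of
    small chromatic number, so they can be removed (otherwise that set has
    large domination number and contains the wanted bounded set).  If [y]
    remains, a triangle among the in-neighbours [x] of [y] for which
    [N+(y) :&: N-(x)] has small chromatic number would dominate most of
    [N+(y)]; so these [x] are few, and one can choose [k+1] vertices greedily
    such that each arc among them lies in triangles whose third vertices form
    a set of large chromatic number.  Picking inside each of these sets a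
    bounded set of chromatic number [k] forces [k+1] colours.
    Finally let [A] be bounded with [chi A > c], and partition the other
    vertices [z] according to [Q = A :&: N-(z)].  Some part is not acyclic and
    has chromatic number at least [c].  If [Q] contains a triangle, it
    dominates the part; otherwise [chi (A :\: Q) >= c], and a triangle in the
    part dominates [A :\: Q]. *)

From mathcomp Require Import all_boot.
From mathcomp Require Import zify.
Require Import Defs.

Set Implicit Arguments.
Unset Strict Implicit.
Unset Printing Implicit Defensive.

(** * Triangles, colourings and subadditivity of the chromatic number *)

Definition triangle (T : tournament) (x y z : T) :=
  [&& arc x y, arc y z & arc z x].

Section Chromatic.

Variable T : tournament.
Implicit Types (x y z : T) (X Y S W A B P : {set T}) (f : T -> nat).

Lemma arc_asym x y : arc x y -> ~~ arc y x.
Proof.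
case: (eqVneq x y) => [->|/arc_tour]; first by rewrite arc_irr.
by case: (arc x y); case: (arc y x).
Qed.

Lemma arc_total x y : x != y -> ~~ arc x y -> arc y x.
Proof. by move/arc_tour; case: (arc x y); case: (arc y x). Qed.

(** A chord shortens the cycle: if [z -> x], the first three vertices form a triangle; otherwise
    [x -> z] and [y] can be skipped. *)
Lemma cycle_triangle X (c : seq T) :
  c != [::] -> ucycle arc c -> {subset c <= X} ->
  exists x y z, [/\ x \in X, y \in X, z \in X & triangle x y z].
Proof.
move: {2}(size c) (leqnn (size c)) => n.
elim: n c => [|n IHn] [|x [|y [|z c]]] //= sz _.
- by rewrite /ucycle /= arc_irr.
- by rewrite /ucycle /= andbT; case/andP=> /andP[/arc_asym/negPf->].
- case/andP=> cy un sub.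
  have [xX yX zX] : [/\ x \in X, y \in X & z \in X].
    by split; apply: sub; rewrite !inE eqxx ?orbT.
  have [zx|nzx] := boolP (arc z x).
    exists x, y, z; split => //; rewrite /triangle zx andbT.
    by move: cy => /= /and3P[-> -> _].
  have xz : arc x z.
    apply: arc_total nzx; apply/eqP => ezx.
    by move: un; rewrite /= !inE ezx eqxx orbT.
  apply: (IHn (x :: z :: c)) => //.
  - rewrite /ucycle /= xz /=; apply/andP; split.
      by move: cy => /= /and3P[].
    move: un; rewrite /= !inE !negb_or.
    by case/andP=> /and3P[_ -> ->] /andP[_].
  - move=> u; rewrite !inE => H; apply: sub; rewrite !inE.
    by case/orP: H => [->|/orP[->|->]]; rewrite ?orbT.
Qed.

Lemma acyclic_triangleP X :
  reflect (forall x y z, x \in X -> y \in X -> z \in X -> ~~ triangle x y z)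
          (acyclic X).
Proof.
apply: (iffP (acyclicP X)) => H.
- move=> x y z xX yX zX; apply/negP => /and3P[xy yz zx].
  apply: (H [:: x; y; z]) => //.
    rewrite /ucycle /= xy yz zx /= andbT !inE negb_or.
    have neq (u v : T) : arc u v -> u != v.
      by apply: contraTneq => ->; rewrite arc_irr.
    by rewrite (neq _ _ xy) (neq _ _ yz) eq_sym (neq _ _ zx).
  by move=> u; rewrite !inE => /or3P[]/eqP->.
- move=> c c0 uc sub.
  have [x [y [z [xX yX zX]]]] := cycle_triangle c0 uc sub.
  by apply/negP; apply: H.
Qed.

(** This trades covers by acyclic sets for colour functions without monochromatic triangles. Classes
    of a cover may overlap, so each vertex picks one class containing it. *)
Lemma chi_leP X k :
  reflect (exists f, (forall x, x \in X -> f x < k) /\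
     forall x y z, x \in X -> y \in X -> z \in X ->
       f x = f y -> f x = f z -> ~~ triangle x y z)
   (chi X <= k).
Proof.
rewrite /chi; case: ex_minnP => m colm minm.
apply: (iffP idP) => [mk|[f [fk ftri]]].
- case/existsP: colm => F /andP[/eqP XF /forallP acF].
  pose f x := if [pick i | x \in F i] is Some i then val i else 0.
  have fP x : x \in X -> exists2 i, f x = val i & x \in F i.
    rewrite XF /f => /bigcupP[j _ xj].
    by case: pickP => [i xi|/(_ j)]; [exists i | rewrite xj].
  exists f; split=> [x /fP[i -> _]|x y z xX yX zX].
    exact: leq_trans (ltn_ord i) mk.
  case: (fP x xX) => i -> xi; case: (fP y yX) => j -> yj.
  case: (fP z zX) => l -> zl /val_inj eij /val_inj eil.
  by subst j l; apply: (acyclic_triangleP _ (acF i)).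
- apply: minm; apply/existsP; exists [ffun i : 'I_k => [set x in X | f x == i]].
  apply/andP; split.
    apply/eqP/setP => x; apply/idP/bigcupP => [xX|[i _]].
      by exists (Ordinal (fk x xX)); rewrite // ffunE inE xX /=.
    by rewrite ffunE inE => /andP[].
  apply/forallP => i; apply/acyclic_triangleP => x y z; rewrite ffunE !inE.
  move=> /andP[xX /eqP fx] /andP[yX /eqP fy] /andP[zX /eqP fz].
  by apply: ftri => //; rewrite fx.
Qed.

Lemma chi_subset X Y : X \subset Y -> chi X <= chi Y.
Proof.
move=> /subsetP sXY; case/chi_leP: (leqnn (chi Y)) => f [fY ft].
by apply/chi_leP; exists f; split => *; [apply: fY | apply: ft]; auto.
Qed.

Lemma chi_setU X Y : chi (X :|: Y) <= chi X + chi Y.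
Proof.
case/chi_leP: (leqnn (chi X)) => f [fX ft].
case/chi_leP: (leqnn (chi Y)) => g [gY gt].
apply/chi_leP; exists (fun x => if x \in X then f x else chi X + g x).
have inY u : u \in X :|: Y -> u \notin X -> u \in Y.
  by rewrite inE => /orP[->|].
split=> [x|x y z] xU; first by case: ifPn => [/fX|/(inY _ xU)/gY]; lia.
move=> yU zU.
have fX' u : u \in X -> f u < chi X by apply: fX.
case: ifPn => xX; case: ifPn => yX; case: ifPn => zX; 
  try (by move=> *; move: (fX' x) (fX' y) (fX' z); rewrite ?xX ?yX ?zX; lia).
- exact: ft.
- by move=> /addnI exy /addnI exz; apply: gt; auto.
Qed.

Lemma chi_set1 x : chi [set x] <= 1.
Proof.
apply/chi_leP; exists (fun=> 0); split=> // y z t /set1P-> /set1P-> _ _ _.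
by rewrite /triangle arc_irr.
Qed.

Lemma chi_le1P X :
  reflect (forall x y z, x \in X -> y \in X -> z \in X -> ~~ triangle x y z)
          (chi X <= 1).
Proof.
apply: (iffP (chi_leP X 1)) => [[f [f1 ft]] x y z xX yX zX|H].
  by apply: ft => //; move: (f1 x xX) (f1 y yX) (f1 z zX); lia.
by exists (fun=> 0); split=> // *; apply: H.
Qed.

Lemma chi_gt1 X : 1 < chi X ->
  exists x y z, [/\ x \in X, y \in X, z \in X & triangle x y z].
Proof.
rewrite ltnNge => nX.
have : ~~ [forall x in X, forall y in X, forall z in X, ~~ triangle x y z].
  apply: contra nX => /forall_inP H; apply/chi_le1P => x y z xX yX zX.
  by move/forall_inP: (H x xX) => /(_ y yX)/forall_inP/(_ z zX).
rewrite negb_forall_in => /exists_inP[x xX].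
rewrite negb_forall_in => /exists_inP[y yX].
rewrite negb_forall_in => /exists_inP[z zX].
by rewrite negbK => t; exists x, y, z.
Qed.

Lemma chi_set0 : chi (set0 : {set T}) = 0.
Proof.
by apply/eqP; rewrite -leqn0; apply/chi_leP; exists (fun=> 0);
   split=> [x|x y z]; rewrite inE.
Qed.

Lemma chi_bigcup (I : finType) (P : {set I}) (F : I -> {set T}) h :
  (forall i, i \in P -> chi (F i) <= h) ->
  chi (\bigcup_(i in P) F i) <= #|P| * h.
Proof.
move=> Fh; rewrite -sum_nat_const.
apply: (big_ind2 (fun X m => chi X <= m)) => [|X m Y n Xm Yn|i iP].
- by rewrite chi_set0.
- exact: leq_trans (chi_setU X Y) (leq_add Xm Yn).
- exact: Fh.
Qed.

Lemma chi_le_card X : chi X <= #|X|.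
Proof.
have XE : X \subset \bigcup_(x in X) [set x].
  by apply/subsetP => x xX; apply/bigcupP; exists x; rewrite ?set11.
apply: leq_trans (chi_subset XE) _; rewrite -[#|X|]muln1.
by apply: chi_bigcup => x _; apply: chi_set1.
Qed.

Lemma chi_setD X Y : chi X <= chi (X :\: Y) + chi Y.
Proof.
apply: leq_trans (chi_setU _ _); apply: chi_subset.
by apply/subsetP => x xX; rewrite !inE xX andbT orNb.
Qed.

(** * Forcing an additional colour *)

(** If colour [i] were missing, the class of colour [k.-1] could be renamed [i], leaving a colouring
    with [k.-1] colours. *)
Lemma colouring_surjective A k f i :
  k <= chi A -> i < k -> (forall x, x \in A -> f x < k) ->
  (forall x y z, x \in A -> y \in A -> z \in A ->
       f x = f y -> f x = f z -> ~~ triangle x y z) ->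
  exists2 a, a \in A & f a = i.
Proof.
move=> kA ik fk ft.
have [/exists_inP[a aA /eqP fa]|] := boolP [exists a in A, f a == i].
  by exists a.
rewrite negb_exists_in => /forall_inP nf.
suff : chi A <= k.-1 by lia.
apply/chi_leP; exists (fun x => if f x == k.-1 then i else f x).
have {}nf x : x \in A -> f x <> i by move/nf/eqP.
split=> [x xA|x y z xA yA zA].
  by have := fk x xA; have := nf x xA; case: (f x =P k.-1); lia.
have inj u v : u \in A -> v \in A ->
    (if f u == k.-1 then i else f u) = (if f v == k.-1 then i else f v) -> f u = f v.
  by move=> /nf nu /nf nv; case: (f u =P k.-1); case: (f v =P k.-1); lia.
by move=> /inj fxy /inj fxz; apply: ft; auto.
Qed.

Lemma colour_class_large W k f :
  W != set0 -> (forall x, x \in W -> f x < k) ->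
  exists2 i, i < k & #|W| <= k * #|[set x in W | f x == i]|.
Proof.
move=> /set0Pn[w wW] fk.
have k0 : 0 < k by have := fk w wW; lia.
have [/existsP[i Hi]|] := boolP [exists i : 'I_k,
    #|W| <= k * #|[set x in W | f x == i]|]; first by exists i.
rewrite negb_exists => /forallP H.
have card : #|W| = \sum_(i < k) #|[set x in W | f x == i]|.
  rewrite -sum1_card (partition_big (fun x => insubd (Ordinal k0) (f x)) xpredT) //=.
  apply: eq_bigr => i _; rewrite -sum1_card; apply: eq_bigl => x; rewrite inE.
  case: (boolP (x \in W)) => //= xW.
  by rewrite -(inj_eq val_inj) val_insubd fk.
have : \sum_(i < k) (k * #|[set x in W | f x == i]| + 1) <= \sum_(i < k) #|W|.
  by apply: leq_sum => i _; rewrite addn1 ltnNge H.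
rewrite big_split /= -big_distrr /= -card !sum_nat_const card_ord; lia.
Qed.

(* In a [k]-colouring of [B], some colour class [S] of [W] is large, its
   colour also occurs in [A S], and this creates a monochromatic triangle. *)
Lemma chi_amplify X W k l :
  W != set0 -> W \subset X ->
  (forall S, S \subset W -> chi S <= 1 -> #|W| <= k * #|S| ->
     exists A, [/\ A \subset X, #|A| <= l, k <= chi A &
       forall a, a \in A -> exists s t, [/\ s \in S, t \in S & triangle a s t]]) ->
  exists B, [/\ B \subset X, #|B| <= #|W| + 2 ^ #|W| * l & k < chi B].
Proof.
move=> W0 WX HS.
(* Choice needs a total family, so subsets that do not qualify as [S] receive [set0]. *)
have /fin_all_exists[A HA] : forall S : {set T}, exists A : {set T},
    [/\ A \subset X, #|A| <= l &
      S \subset W -> chi S <= 1 -> #|W| <= k * #|S| -> k <= chi A /\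
       forall a, a \in A -> exists s t, [/\ s \in S, t \in S & triangle a s t]].
  move=> S.
  have [/and3P[p q r]|n] :=
      boolP [&& S \subset W, chi S <= 1 & #|W| <= k * #|S|].
    by have [A [? ? ? ?]] := HS S p q r; exists A; split.
  exists set0; rewrite sub0set cards0; split => // p q r.
  by rewrite p q r in n.
(* The class [S] depends on the colouring, so the witness includes [A S] for every subset of [W]. *)
exists (W :|: \bigcup_(S in powerset W) A S); split.
- rewrite subUset WX; apply/bigcupsP => S _; by case: (HA S).
- apply: leq_trans (leq_card_setU _ _) _; rewrite leq_add2l -card_powerset.
  rewrite -sum_nat_const.
  apply: (big_ind2 (fun (Y : {set T}) m => #|Y| <= m)) => [|Y m Z n Ym Zn|S _].
  + by rewrite cards0.
  + exact: leq_trans (leq_card_setU _ _) (leq_add Ym Zn).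
  + by case: (HA S).
- rewrite ltnNge; apply/negP => /chi_leP[f [fk ft]].
  have fW x : x \in W -> f x < k by move=> xW; apply: fk; rewrite inE xW.
  have [i ik Hi] := colour_class_large W0 fW.
  set S := [set x in W | f x == i] in Hi.
  have SW : S \subset W by apply/subsetP => x; rewrite inE => /andP[].
  have SP x : x \in S -> x \in W /\ f x = i.
    by rewrite inE => /andP[? /eqP].
  have S1 : chi S <= 1.
    apply/chi_le1P => x y z /SP[xW fx] /SP[yW fy] /SP[zW fz].
    by apply: ft; rewrite ?fx ?fy ?fz ?inE ?xW ?yW ?zW.
  have [_ _ /(_ SW S1 Hi)[kA triA]] := HA S.
  have AB x : x \in A S -> x \in W :|: \bigcup_(S in powerset W) A S.
    move=> xA; rewrite inE; apply/orP; right; apply/bigcupP; exists S => //.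
    by rewrite powersetE.
  have [a aA fa] : exists2 a, a \in A S & f a = i.
    by apply: (@colouring_surjective (A S) k) => // *; [apply: fk|apply: ft]; auto.
  have [s [t [/SP[sW fs] /SP[tW ft'] ast]]] := triA a aA.
  suff : ~~ triangle a s t by rewrite ast.
  by apply: ft; rewrite ?fs ?ft' //; [exact: AB | rewrite inE sW | rewrite inE tW].
Qed.

(** * Domination and bounded sets of large chromatic number *)

(** A vertex [s] of maximum out-degree in [S] works: if [t] beat [s], acyclicity would make [t] beat
    everything that [s] beats, and [s] as well. *)
Lemma acyclic_source S : S != set0 -> chi S <= 1 ->
  exists2 s, s \in S & forall t, t \in S -> t != s -> arc s t.
Proof.
move=> /set0Pn[s0 s0S] /chi_le1P ac.
have [s sS smax] := @arg_maxnP _ s0 (mem S) (fun s => #|[set u in S | arc s u]|) s0S.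
have {}sS : s \in S by [].
exists s => // t tS nts; apply: contraT => nst.
have ts : arc t s by apply: arc_total nst; rewrite eq_sym.
suff : #|[set u in S | arc s u]| < #|[set u in S | arc t u]|.
  by rewrite ltnNge => /negP[]; apply: smax.
apply/proper_card/properP; split.
  apply/subsetP => u; rewrite !inE => /andP[uS su]; rewrite uS /=.
  apply: contraT => ntu; have := ac t s u tS sS uS; rewrite /triangle ts su /=.
  rewrite (arc_total _ ntu) //; apply: contraNneq ntu => etu.
  by rewrite -etu (negPf nst) in su.
by exists s; rewrite inE ?sS ?arc_irr ?ts ?andbF.
Qed.

Definition dominates (P X : {set T}) : bool :=
  [forall x in X, (x \in P) || [exists p in P, arc p x]].

Lemma dominatesPn P X :
  reflect (exists2 x, x \in X & x \notin P /\ forall p, p \in P -> ~~ arc p x)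
          (~~ dominates P X).
Proof.
rewrite /dominates negb_forall_in.
apply: (iffP exists_inP) => -[x xX].
  rewrite negb_or negb_exists_in => /andP[xP /forall_inP H]; exists x => //.
case=> xP H; exists x => //; rewrite negb_or xP negb_exists_in.
exact/forall_inP.
Qed.

Definition domination_ge (K : nat) X :=
  forall P, P \subset X -> #|P| < K -> ~~ dominates P X.

End Chromatic.

(* Take a minimum dominating set [D], a large [S \subset D] with source [s],
   and let [U] be the set of vertices not dominated by [s |: (D :\: S)].  Each
   [a] in [U] has an in-neighbour [t] in [S], whence a triangle [a -> s -> t -> a],
   and by minimality of [D] the set [U] still has large domination number. *)
Lemma domination_chi k : exists K l, forall (T : tournament) (X : {set T}),
  domination_ge K X ->
  exists A : {set T}, [/\ A \subset X, #|A| <= l & k <= chi A].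
Proof.
elim: k => [|k [K [l IH]]].
  by exists 0, 0 => T X _; exists set0; rewrite sub0set cards0.
(* With [k * K + 1] vertices in [W], the bound [#|W| <= k * #|S|] forces [K < #|S|]; the first
   constant makes [D] large enough to contain such a [W]. *)
exists (k * K).+2, ((k * K).+1 + 2 ^ (k * K).+1 * l) => T X domX.
have domXX : (X \subset X) && dominates X X.
  by rewrite subxx; apply/forall_inP => x ->.
have [D /andP[DX domD] Dmin] :=
  @arg_minnP _ X (fun D => (D \subset X) && dominates D X) (fun D => #|D|) domXX.
have cD : (k * K).+1 < #|D|.
  by rewrite ltnNge; apply/negP => cD; have := domX D DX cD; rewrite domD.
have [W /andP[WD /eqP cW]] : exists W : {set T}, (W \subset D) && (#|W| == (k * K).+1).
  exists [set x in take (k * K).+1 (enum D)]; apply/andP; split.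
    by apply/subsetP => x; rewrite inE => /mem_take; rewrite mem_enum.
  rewrite cardsE; have /card_uniqP -> : uniq (take (k * K).+1 (enum D)).
    by rewrite take_uniq ?enum_uniq.
  by rewrite size_takel // -cardE ltnW.
have WX := subset_trans WD DX.
rewrite -cW; apply: chi_amplify => //; first by rewrite -card_gt0 cW.
move=> S SW S1 cS.
have KS : K < #|S|.
  rewrite ltnNge; apply/negP => /(leq_mul (leqnn k)).
  by move: cS; rewrite cW => /leq_trans H /H; rewrite ltnn.
have S0 : S != set0 by rewrite -card_gt0; lia.
have [s sS ssrc] := acyclic_source S0 S1.
pose Q := s |: (D :\: S).
pose U := [set x in X | (x \notin Q) && [forall p in Q, ~~ arc p x]].
have UX : U \subset X by apply/subsetP => x; rewrite inE => /andP[].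
have sD : s \in D by apply: (subsetP WD); apply: (subsetP SW).
have domU : domination_ge K U.
  move=> P PU cP; apply/dominatesPn.
  (* Otherwise [P :|: Q], of size at most [#|P| + 1 + #|D| - #|S| < #|D|], would contradict the
     minimality of [D]. A vertex it misses lies in [U] and is missed by [P]. *)
  have : ~~ dominates (P :|: Q) X.
    apply/negP => dPQ.
    have /Dmin : (P :|: Q \subset X) && dominates (P :|: Q) X.
      rewrite dPQ andbT !subUset (subset_trans PU UX) sub1set (subsetP DX) //=.
      by rewrite subDset (subset_trans DX) // subsetUr.
    rewrite leqNgt => /negP; apply.
    have [+ _] := leq_card_setU P Q; have : #|Q| <= 1 + #|D :\: S|.
      by rewrite cardsU1 leq_add2r leq_b1.
    have := cardsD D S; have /setIidPr -> : S \subset D := subset_trans SW WD.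
    have := subset_leq_card (subset_trans SW WD); lia.
  case/dominatesPn => x xX [xPQ nx]; exists x.
    move: xPQ; rewrite in_setU negb_or => /andP[_ xQ]; rewrite [x \in U]inE xX xQ /=.
    by apply/forall_inP => p pQ; apply: nx; rewrite in_setU pQ orbT.
  move: xPQ; rewrite in_setU negb_or => /andP[-> _]; split=> // p pP.
  by apply: nx; rewrite in_setU pP.
have [A [AU cA kA]] := IH T U domU.
exists A; split=> //; first exact: subset_trans AU UX.
move=> a /(subsetP AU); rewrite inE => /and3P[aX aQ /forall_inP na].
have sQ : s \in Q by rewrite /Q setU11.
have aDS p : p \in D -> p \notin S -> ~~ arc p a.
  by move=> pD pS; apply: na; rewrite /Q !inE pS pD orbT.
have as_ : arc a s.
  apply: arc_total (na s sQ); apply: contraNneq aQ => <-; exact: sQ.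
(* [D] dominates [a], but no vertex of [D :\: S] beats it. If [a] were in [D], it would be in [S],
   and [s] would beat it. *)
have [t tS ta] : exists2 t, t \in S & arc t a.
  have/orP[aD|/exists_inP[t tD ta]] := forall_inP domD a aX.
    move: aQ; rewrite /Q !inE aD andbT negb_or negbK => /andP[nas aS].
    by have := ssrc a aS nas; rewrite (negPf (na s sQ)).
  exists t => //; apply: contraTT ta => tS; exact: aDS.
exists s, t; split=> //; rewrite /triangle as_ ta andbT /=.
by apply: ssrc => //; apply: contraTneq ta => ->; apply: na.
Qed.

(** If [P] dominates [L], then [L] is covered by the vertices [p] of [P] with their
    out-neighbourhoods in [L], each such piece having chromatic number at most [h + 1]. So large
    [chi L] forces large domination number. *)
Lemma local_to_global k h : exists q l, forall (T : tournament) (L : {set T}),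
  (forall y, y \in L -> chi (L :&: [set z | arc y z]) <= h) -> q <= chi L ->
  exists A : {set T}, [/\ A \subset L, #|A| <= l & k <= chi A].
Proof.
have [K [l H]] := domination_chi k.
exists (K * h.+1).+1, l => T L low qL; apply: H => P PL cP.
apply/negP => /forall_inP dom.
have : chi L <= #|P| * h.+1.
  apply: leq_trans (chi_bigcup (F := fun p => p |: (L :&: [set z | arc p z])) _).
    apply: chi_subset; apply/subsetP => x xL; apply/bigcupP.
    case/orP: (dom x xL) => [xP|/exists_inP[p pP px]].
      by exists x; rewrite ?setU11.
    by exists p; rewrite // !inE xL px orbT.
  move=> p pP; apply: leq_trans (chi_setU _ _) _.
  by rewrite -[h.+1]add1n leq_add ?chi_set1 ?low ?(subsetP PL).
have := leq_mul (ltnW cP) (leqnn h.+1); lia.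
Qed.

(** * Tournaments whose triangles dominate only sets of small chromatic number *)

(** The failure of the theorem's conclusion for [c], with the triangle given by its vertices. *)
Definition triangles_dominate_lt (T : tournament) (c : nat) : Prop :=
  forall (x y z : T) (B : {set T}), triangle x y z ->
    (forall b, b \in B -> [&& arc x b, arc y b & arc z b]) -> chi B < c.

Lemma chi_cover3 (T : tournament) (X N1 N2 N3 B : {set T}) :
  X \subset N1 :|: N2 :|: N3 :|: B ->
  chi X <= chi N1 + chi N2 + chi N3 + chi B.
Proof.
move=> /chi_subset /leq_trans; apply.
have := chi_setU (N1 :|: N2 :|: N3) B; have := chi_setU (N1 :|: N2) N3.
have := chi_setU N1 N2; lia.
Qed.

(** Otherwise a triangle in [X] would dominate all of [X] but its vertices and their in-neighbours,
    a set of chromatic number at most [3 * (t + 1)]. *)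
Lemma exists_large_in_neighbourhood (T : tournament) c t (X : {set T}) :
  triangles_dominate_lt T c -> 3 * t + c + 3 < chi X ->
  exists2 y, y \in X & t < chi (X :&: [set x | arc x y]).
Proof.
move=> noT big.
have [/exists_inP[y yX ty]|] :=
  boolP [exists y in X, t < chi (X :&: [set x | arc x y])]; first by exists y.
rewrite negb_exists_in => /forall_inP low; exfalso.
have X1 : 1 < chi X by lia.
have [x [y [z [xX yX zX xyz]]]] := chi_gt1 X1.
pose N w := w |: (X :&: [set x | arc x w]).
have cN w : w \in X -> chi (N w) <= t.+1.
  move=> /low; rewrite -leqNgt => wt; apply: leq_trans (chi_setU _ _) _.
  by have := chi_set1 w; lia.
pose B := X :\: (N x :|: N y :|: N z).
have : chi B < c.
  apply: (noT x y z) => // b; rewrite !inE !negb_or => /andP[+ bX].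
  rewrite bX /= => /andP[/andP[/andP[b1 b2] /andP[b3 b4]] /andP[b5 b6]].
  by rewrite !(arc_total _ b2, arc_total _ b4, arc_total _ b6).
have /chi_cover3 : X \subset N x :|: N y :|: N z :|: B.
  by apply/subsetP => b bX; rewrite in_setU in_setD bX andbT orbN.
have := cN x xX; have := cN y yX; have := cN z zX; lia.
Qed.

(** Greedy choice: take [y] with a large in-neighbourhood and continue among the in-neighbours [x]
    with [E x y]; dropping the others costs at most one colour. Every arc of [W] thus points to the
    vertex chosen earlier. *)
Lemma exists_chain c n : exists t, forall (T : tournament) (E : rel T) (X : {set T}),
  triangles_dominate_lt T c ->
  (forall y, y \in X -> chi (X :&: [set x | arc x y && ~~ E x y]) <= 1) ->
  t <= chi X ->
  exists W : {set T}, [/\ W \subset X, #|W| = n &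
    forall u v, u \in W -> v \in W -> arc u v -> E u v].
Proof.
elim: n => [|n [t IH]].
  by exists 0 => T E X _ _ _; exists set0; rewrite sub0set cards0; split=> // u v; rewrite inE.
exists (3 * t.+1 + c + 4) => T E X noT hE big.
have [y yX hy] : exists2 y, y \in X & t.+1 < chi (X :&: [set x | arc x y]).
  by apply: (exists_large_in_neighbourhood noT); lia.
pose X' := X :&: [set x | arc x y && E x y].
have X'X : X' \subset X by apply: subsetIl.
have tX' : t <= chi X'.
  have /chi_subset : X :&: [set x | arc x y] \subset
      X' :|: (X :&: [set x | arc x y && ~~ E x y]).
    by apply/subsetP => x; rewrite !inE => /andP[-> ->] /=; rewrite orbN.
  have := chi_setU X' (X :&: [set x | arc x y && ~~ E x y]).
  have := hE y yX; lia.
have [|W [WX' cW WE]] := IH T E X' noT _ tX'.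
  move=> z zX'; apply: leq_trans (hE z (subsetP X'X z zX')).
  by apply: chi_subset; apply: setSI.
have Wy u : u \in W -> arc u y && E u y.
  by move=> /(subsetP WX'); rewrite !inE => /andP[].
exists (y |: W); split.
- by rewrite subUset sub1set yX (subset_trans WX').
- rewrite cardsU1 cW; case: (boolP (y \in W)) => [/Wy|//].
  by rewrite arc_irr.
- move=> u v; rewrite !inE => /orP[/eqP->|uW] /orP[/eqP->|vW].
  + by rewrite arc_irr.
  + by case/andP: (Wy v vW) => /arc_asym/negPf->.
  + by case/andP: (Wy u uW).
  + exact: WE.
Qed.

Lemma bounded_subtournament c k : exists s l, forall (T : tournament),
  triangles_dominate_lt T c -> forall X : {set T}, s <= chi X ->
  exists A : {set T}, [/\ A \subset X, #|A| <= l & k <= chi A].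
Proof.
elim: k => [|k [s [l IH]]].
  by exists 0, 0 => T _ X _; exists set0; rewrite sub0set cards0.
(* An out-neighbourhood above [3 * s + c] cannot be covered by three sets of chromatic number below
   [s] and one below [c]. *)
have [q [l1 low]] := local_to_global k.+1 (3 * s + c).
(* Among [k.+1] vertices in [k] colours, a largest class has two vertices, hence an arc. *)
have [t chain] := exists_chain c k.+1.
(* [q] serves the case where [L] is large, [t] the case where [X :\: L] is. *)
exists (q + t), (l1 + (k.+1 + 2 ^ k.+1 * l)) => T noT X big.
pose L := [set y in X | chi (X :&: [set z | arc y z]) <= 3 * s + c].
have LX : L \subset X by apply/subsetP => y; rewrite inE => /andP[].
have [qL|Lq] := leqP q (chi L).
  have [|A [AL cA kA]] := low T L _ qL.
    move=> y; rewrite inE => /andP[_]; apply: leq_trans.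
    by apply: chi_subset; apply: setSI.
  exists A; split=> //; first exact: subset_trans AL LX.
  exact: leq_trans cA (leq_addr _ _).
(* For an arc from [x] to [y], this set consists of the third vertices of the triangles through
   it. *)
pose E (x y : T) := s <= chi (X :&: [set z | arc y z && arc z x]).
have [||W [WX cW WE]] := chain T E (X :\: L) noT.
- move=> y; rewrite !inE => /andP[+ yX]; rewrite yX /= -ltnNge => hy.
  apply/chi_le1P => x1 x2 x3; rewrite !inE /E -!ltnNge.
  move=> /and3P[_ a1 e1] /and3P[_ a2 e2] /and3P[_ a3 e3].
  apply/negP => tri.
  pose N x := X :&: [set z | arc y z && arc z x].
  (* The triangle [x1 x2 x3] dominates [B], which is most of [N+(y)]. *)
  pose B := (X :&: [set z | arc y z]) :\: (N x1 :|: N x2 :|: N x3).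
  have : chi B < c.
    apply: (noT x1 x2 x3) => // b; rewrite !inE !negb_or.
    move=> /andP[+ /andP[bX yb]]; rewrite bX yb /= => /andP[/andP[b1 b2] b3].
    have nb x : arc x y -> b != x.
      by apply: contraTneq => <-; apply: arc_asym.
    by rewrite !(arc_total _ b1, arc_total _ b2, arc_total _ b3) ?nb.
  have /chi_cover3 : X :&: [set z | arc y z] \subset N x1 :|: N x2 :|: N x3 :|: B.
    by apply/subsetP => b bX; rewrite in_setU in_setD bX andbT orbN.
  move: e1 e2 e3 hy; rewrite -/(N x1) -/(N x2) -/(N x3); lia.
- by have := chi_setD X L; lia.
have WX' : W \subset X by apply: subset_trans WX (subsetDl _ _).
have W0 : W != set0 by rewrite -card_gt0 cW.
have [|B [BX cB kB]] := @chi_amplify T X W k l W0 WX'.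
  move=> S SW S1; rewrite cW => cS.
  have : 1 < #|S|.
    by rewrite ltnNge; apply/negP => /(leq_mul (leqnn k)); lia.
  case/card_gt1P => u [v [uS vS nuv]].
  wlog uv : u v uS vS nuv / arc u v.
    move=> Hw; have [|/arc_total vu] := boolP (arc u v); first exact: Hw.
    by apply: (Hw v u); rewrite // ?vu // eq_sym.
  have sE : E u v by apply: WE => //; apply: (subsetP SW).
  have [A [AU cA kA]] := IH T noT _ sE.
  exists A; split=> //; first by apply: subset_trans AU (subsetIl _ _).
  move=> a /(subsetP AU); rewrite !inE => /and3P[_ va au].
  by exists u, v; rewrite /triangle au uv va.
exists B; split=> //; rewrite cW in cB; lia.
Qed.

(** * Partition by in-neighbourhoods in a bounded set, and the theorem *)

Lemma chi_bounded c : exists d, forall T : tournament,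
  triangles_dominate_lt T c -> chi [set: T] < d.
Proof.
have [s [l H]] := bounded_subtournament c c.+1.
(* [A] contributes at most [l] and each of at most [2 ^ l] parts at most [c.+1]; [s] serves the case
   where [chi [set: T]] is too small to provide [A]. *)
exists (s + (l + 2 ^ l * c.+1)).+1 => T noT; rewrite ltnS.
have [sT|] := leqP s (chi [set: T]); last by lia.
have [A [_ cA kA]] := H T noT _ sT.
pose F (Q : {set T}) := [set z | (z \notin A) && (A :&: [set a | arc a z] == Q)].
have cF Q : Q \in powerset A -> chi (F Q) <= c.+1.
  rewrite powersetE => QA; rewrite leqNgt; apply/negP => big.
  have [Q1|/chi_gt1[x [y [z [xQ yQ zQ xyz]]]]] := leqP (chi Q) 1; last first.
    suff : chi (F Q) < c by lia.
    apply: (noT x y z) => // b; rewrite inE => /andP[_ /eqP eQ].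
    by move: xQ yQ zQ; rewrite -eQ !inE => /andP[_ ->] /andP[_ ->] /andP[_ ->].
  have : 1 < chi (F Q) by lia.
  case/chi_gt1 => x [y [z [xF yF zF xyz]]].
  suff : chi (A :\: Q) < c by have := chi_setD A Q; lia.
  apply: (noT x y z) => // b; rewrite inE => /andP[bQ bA].
  have Fb w : w \in F Q -> arc w b.
    rewrite inE => /andP[wA /eqP eQ]; apply: arc_total.
      by apply: contraNneq wA => <-.
    by apply: contra bQ => bw; rewrite -eQ !inE bA.
  by rewrite !Fb.
have : chi [set: T] <= chi (A :|: \bigcup_(Q in powerset A) F Q).
  apply: chi_subset; apply/subsetP => z _; rewrite inE.
  have [//|zA] := boolP (z \in A); apply/bigcupP.
  by exists (A :&: [set a | arc a z]); rewrite ?powersetE ?subsetIl // inE zA /=.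
have := chi_setU A (\bigcup_(Q in powerset A) F Q).
have := chi_bigcup cF; rewrite card_powerset.
have := chi_le_card A.
have : 2 ^ #|A| * c.+1 <= 2 ^ l * c.+1.
  by rewrite leq_mul2r leq_exp2l // cA orbT.
lia.
Qed.

Theorem mainTheorem1 :
  forall c : nat, exists d : nat, forall T : tournament,
    d <= chi [set: T] ->
    exists A B : {set T},
      [/\ complete_pair A B, cyclic_triangle A & c <= chi B].
Proof.
move=> c; have [d Hd] := chi_bounded c; exists d => T dT.
(* This is the largest set dominated by [x], [y], [z]. By monotonicity of [chi] only it needs
   testing, which makes the existence of a good triangle boolean. *)
pose N (x y z : T) := [set b | [&& arc x b, arc y b & arc z b]].
have [/existsP[x /existsP[y /existsP[z /andP[xyz cN]]]]|none] :=
  boolP [exists x, exists y, exists z, triangle x y z && (c <= chi (N x y z))];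
  last first.
  suff : chi [set: T] < d by rewrite ltnNge dT.
  apply: Hd => x y z B xyz domB.
  have cB : chi B <= chi (N x y z).
    by apply: chi_subset; apply/subsetP => b /domB; rewrite inE.
  apply: leq_ltn_trans cB _; rewrite ltnNge; apply: contra none => cN.
  apply/existsP; exists x; apply/existsP; exists y; apply/existsP; exists z.
  by rewrite xyz.
have dom a b : a \in [set x; y; z] -> b \in N x y z -> arc a b.
  by rewrite !inE -orbA => /or3P[]/eqP-> /and3P[].
exists [set x; y; z], (N x y z); split=> //.
  split=> [|a b aA bB]; last by apply: arc_asym; apply: dom.
  rewrite -setI_eq0; apply/eqP/setP => a; rewrite inE [RHS]inE.
  by apply/negP => /andP[aA aB]; have := dom a a aA aB; rewrite arc_irr.
have [xy yz zx] : [/\ arc x y, arc y z & arc z x] by case/and3P: xyz.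
have neq (u v : T) : arc u v -> u != v.
  by apply: contraTneq => ->; rewrite arc_irr.
have nxz : x != z by rewrite eq_sym neq.
split.
  by rewrite -setUA cardsU1 cards2 !inE negb_or (neq x y) // nxz neq.
(* Allowing any listing [u], [v], [w] of the vertices lets one argument serve the three
   rotations. *)
have one (u v w : T) : arc u v -> arc w u ->
    (forall t, (t \in [set x; y; z]) = (t \in [set u; v; w])) ->
    #|[set t in [set x; y; z] | arc u t]| = 1.
  move=> uv wu eqs; rewrite -(cards1 v); congr #|pred_of_set _|; apply/setP => t.
  rewrite inE eqs !inE -orbA; apply/andP/eqP => [[/or3P[]/eqP->]|->] //.
  - by rewrite arc_irr.
  - by rewrite (negPf (arc_asym wu)).
  - by rewrite eqxx orbT.
move=> u; rewrite !inE -orbA => /or3P[]/eqP->.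
- by apply: (one x y z).
- by apply: (one y z x) => // t; rewrite !inE; do 3 case: (_ == _).
- by apply: (one z x y) => // t; rewrite !inE; do 3 case: (_ == _).
Qed.
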